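(* Let $\beta\equiv\beta^{(4)}$ be a normalized nc sequence with a moment matrix $\mathcal M_2$ of rank 5 satisfying the column relations $\mathbb X\mathbb Y+\mathbb Y\mathbb X=\mathbf 0$ and $\mathbb X^2=\mathbb Y^2$. Then $\beta$ admits a nc measure if and only if $\mathcal M_2$ is positive semidefinite and $\beta_X=\beta_Y=0$. In this case the minimal measure is unique (up to orthogonal equivalence) and of type $(1,1)$.
   Context: Words are elements of the free monoid on noncommuting letters $X,Y$; $|w|$ is the length of $w$, $w^*$ its reverse, and $v,w$ are cyclically equivalent if $v$ is a cyclic permutation of $w$. A sequence $\beta\equiv\beta^{(4)}=(\beta_w)_{|w|\le4}$ is a family of real numbers with $\beta_v=\beta_w$ for cyclically equivalent $v,w$ and $\beta_w=\beta_{w^*}$. It is normalized if $\beta_1=1$, and a nc sequence if $\beta_{X^2Y^2}\ne\beta_{XYXY}$. Its moment matrix $\mathcal M_2$ is the symmetric $7\times7$ matrix with rows and columns indexed by $1,X,Y,X^2,XY,YX,Y^2$ and $(U,V)$ entry $\beta_{U^*V}$; the column indexed by $w$ is denoted $w(\mathbb X,\mathbb Y)$, and ''satisfies a relation'' means that the corresponding linear relation between columns holds. A representing measure for $\beta$ consists of finitely many pairs $(A_i,B_i)$ (atoms) of real symmetric $t_i\times t_i$ matrices ($t_i$ is the size) and numbers $\lambda_i>0$ (densities) with $\sum_i\lambda_i=1$ and $\beta_w=\sum_i\lambda_i\mathrm{Tr}(w(A_i,B_i))$ for all $|w|\le4$, where $\mathrm{Tr}(A)=\frac1t\mathrm{tr}(A)$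 for $A\in\mathbb R^{t\times t}$. It is of type $(m_1,\dots,m_r)$ if it has exactly $m_i$ atoms of size $i$ and $m_r\neq0$. It is minimal if no other representing measure has smaller type, where types are compared first by $r$, then by $m_r$, then $m_{r-1}$, ..., then $m_1$. $\beta$ admits a nc measure if it has a minimal representing measure of type $(m_1,\dots,m_r)$ with $r>1$. Orthogonal equivalence means replacing atoms $(A,B)$ by $(UAU^t,UBU^t)$ with $U$ orthogonal. *)

(* Defs.v *)
From mathcomp Require Import all_boot all_order all_algebra reals.

Set Implicit Arguments.
Unset Strict Implicit.
Unset Printing Implicit Defensive.

Import Order.TTheory GRing.Theory Num.Theory.
Local Open Scope ring_scope.

Notation letter := bool (only parsing).
Notation lX := false (only parsing).
Notation lY := true (only parsing).

Definition word := seq letter.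

Definition cyc_equiv (v w : word) : Prop := exists k : nat, w = rot k v.

(* A truncated sequence of order 4 is represented by a total function on words;
   its values on words of length > 4 are unconstrained and never used. *)
Definition is_sequence (R : realType) (beta : word -> R) : Prop :=
  (forall v w : word, (size v <= 4)%N -> cyc_equiv v w -> beta v = beta w) /\
  (forall w : word, (size w <= 4)%N -> beta w = beta (rev w)).

Definition normalized (R : realType) (beta : word -> R) : Prop :=
  beta [::] = 1.

Definition nc_sequence (R : realType) (beta : word -> R) : Prop :=
  beta [:: lX; lX; lY; lY] <> beta [:: lX; lY; lX; lY].

Definition monomials : 7.-tuple word :=
  [tuple [::]; [:: lX]; [:: lY];
         [:: lX; lX]; [:: lX; lY]; [:: lY; lX]; [:: lY; lY]].

Definition moment_mx (R : realType) (beta : word -> R) : 'M[R]_7 :=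
  \matrix_(i < 7, j < 7) beta (rev (tnth monomials i) ++ tnth monomials j).

(* Meaningful for w in monomials, i.e., for words of length at most 2. *)
Definition moment_col (R : realType) (beta : word -> R) (w : word) : 'cV[R]_7 :=
  col (inord (index w monomials)) (moment_mx beta).

Definition psdmx (R : realType) (n : nat) (M : 'M[R]_n) : Prop :=
  M^T = M /\ forall v : 'cV[R]_n, 0 <= (v^T *m M *m v) 0 0.

Record atom (R : realType) := Atom {
  atom_size : nat;
  atom_X : 'M[R]_atom_size;
  atom_Y : 'M[R]_atom_size }.

Definition wf_atom (R : realType) (a : atom R) : Prop :=
  [/\ (0 < atom_size a)%N,
      (atom_X a)^T = atom_X a & (atom_Y a)^T = atom_Y a].

Definition word_eval (R : realType) (t : nat) (A B : 'M[R]_t) (w : word) :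
    'M[R]_t :=
  foldr (fun (l : letter) (M : 'M[R]_t) => (if l == lX then A else B) *m M)
    1%:M w.

Definition ntrace (R : realType) (t : nat) (A : 'M[R]_t) : R := \tr A / t%:R.

(* A finite list of atoms with densities. Repeated (or equivalent) atoms are
   allowed and counted with multiplicity. *)
Record measure (R : realType) := Measure {
  natoms : nat;
  density : 'I_natoms -> R;
  atom_at : 'I_natoms -> atom R }.

Definition represents (R : realType) (beta : word -> R) (mu : measure R) :
    Prop :=
  [/\ forall i : 'I_(natoms mu), wf_atom (atom_at i),
      forall i : 'I_(natoms mu), 0 < density i,
      \sum_(i < natoms mu) density i = 1
    & forall w : word, (size w <= 4)%N ->
        beta w = \sum_(i < natoms mu)
          density i * ntrace (word_eval (atom_X (atom_at i))
                                        (atom_Y (atom_at i)) w)].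

Definition natoms_of_size (R : realType) (mu : measure R) (t : nat) : nat :=
  #|[set i : 'I_(natoms mu) | atom_size (atom_at i) == t]|.

Definition max_size (R : realType) (mu : measure R) : nat :=
  (\max_(i < natoms mu) atom_size (atom_at i))%N.

(* The type (m_1, ..., m_r) as a list: the entry at index k is m_(k+1). *)
Definition mtype (R : realType) (mu : measure R) : seq nat :=
  mkseq (fun k => natoms_of_size mu k.+1) (max_size mu).

Definition type_lt (s t : seq nat) : Prop :=
  (size s < size t)%N \/
  (size s = size t /\
   exists i : nat,
     [/\ (i < size s)%N, (nth 0%N s i < nth 0%N t i)%N
       & forall j : nat, (i < j < size s)%N -> nth 0%N s j = nth 0%N t j]).

Definition is_minimal (R : realType) (beta : word -> R) (mu : measure R) :
    Prop :=
  represents beta mu /\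
  forall nu : measure R, represents beta nu -> ~ type_lt (mtype nu) (mtype mu).

Definition admits_nc_measure (R : realType) (beta : word -> R) : Prop :=
  exists mu : measure R, is_minimal beta mu /\ (1 < size (mtype mu))%N.

(* U has shape size b x size a, which avoids a cast; the two orthogonality
   equations force the two sizes to be equal. *)
Definition atom_orth_equiv (R : realType) (a b : atom R) : Prop :=
  exists U : 'M[R]_(atom_size b, atom_size a),
    [/\ U *m U^T = 1%:M, U^T *m U = 1%:M,
        atom_X b = U *m atom_X a *m U^T & atom_Y b = U *m atom_Y a *m U^T].

Definition orth_equiv (R : realType) (mu nu : measure R) : Prop :=
  exists f : 'I_(natoms mu) -> 'I_(natoms nu),
    bijective f /\
    forall i : 'I_(natoms mu),
      density (f i) = density i /\
      atom_orth_equiv (atom_at i) (atom_at (f i)).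

(* Main.v *)
(* The column relations and cyclic invariance force every moment of beta to be
   determined by b_X, b_Y, a = b_XX and b = b_XXXX.  Each atom (A, B) of a
   representing measure satisfies AB + BA = 0 and A^2 = B^2, which forces
   tr A = tr B = 0; hence b_X = b_Y = 0, size-1 atoms are (0, 0), and 2 x 2 atoms
   satisfy A^2 = B^2 = c^2 I.  Conversely, rank 5 and positivity amount to a > 0
   and b > a^2, and then beta is represented by density 1 - a^2/b at (0, 0) and
   density a^2/b at c diag(1, -1), c [[0, 1], [1, 0]] with c^2 = b/a.  Size-1
   atoms alone would give b = 0 and a single 2 x 2 atom would give b = a^2, so
   type (1, 1) is minimal; the values a and b fix both c and the densities. *)
Require Import Defs.
From mathcomp Require Import all_boot all_order all_algebra reals.
From mathcomp Require Import ring lra zify.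

Import Order.TTheory GRing.Theory Num.Theory.
Local Open Scope ring_scope.

(** * Gram traces, and symmetric pairs that anticommute and have equal squares *)

Lemma mxtrace_gram {R : realType} {m n} (P : 'M[R]_(m, n)) :
  \tr (P^T *m P) = \sum_i \sum_j P j i ^+ 2.
Proof.
by apply: eq_bigr => i _; rewrite mxE; apply: eq_bigr => j _; rewrite mxE expr2.
Qed.

Lemma mxtrace_gram_ge0 {R : realType} {m n} (P : 'M[R]_(m, n)) :
  0 <= \tr (P^T *m P).
Proof.
by rewrite mxtrace_gram; do 2![apply: sumr_ge0 => ? _]; apply: sqr_ge0.
Qed.

Lemma mxtrace_gram_eq0 {R : realType} {m n} (P : 'M[R]_(m, n)) :
  \tr (P^T *m P) = 0 -> P = 0.
Proof.
rewrite mxtrace_gram => /eqP; rewrite psumr_eq0; last first.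
  by move=> i _; apply: sumr_ge0 => j _; apply: sqr_ge0.
move=> /allP h; apply/matrixP => j i; rewrite mxE.
have /= := h i (mem_index_enum i).
rewrite psumr_eq0; last by move=> *; apply: sqr_ge0.
by move/allP/(_ j (mem_index_enum j)) => /=; rewrite sqrf_eq0 => /eqP.
Qed.

(** For [K] the cokernel matrix of [B], the Gram trace of [A K] is
    [tr (K^T A A K) = tr (K^T B B K) = 0], so [A K = 0]. *)
Lemma sqr_eq_submx {R : realType} {t} {A B : 'M[R]_t} :
  A^T = A -> B^T = B -> A *m A = B *m B -> (A <= B)%MS.
Proof.
move=> sA sB e; rewrite submxE; apply/eqP; apply: mxtrace_gram_eq0.
rewrite trmx_mul sA -mulmxA (mulmxA A A) e -(mulmxA B B) mulmx_coker.
by rewrite !mulmx0 mxtrace0.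
Qed.

(* A generalized inverse G of B satisfies A G B = A = B G A, so
   tr A = tr (B A G) = - tr (A B G) = - tr (B G A) = - tr A. *)
Lemma anticomm_mxtrace0 {R : realType} {t} {A B : 'M[R]_t} :
  A^T = A -> B^T = B -> A *m B + B *m A = 0 -> A *m A = B *m B -> \tr A = 0.
Proof.
move=> sA sB eAB e; have sub := sqr_eq_submx sA sB e.
set G := pinvmx B.
have h1 : A *m G *m B = A by apply: mulmxKpV.
have h3 : B *m G *m B = B by apply: mulmxKpV.
(* By symmetry [A = V B] becomes [A = B V^T], so the columns of [A] lie in the column space of
   [B]. *)
have h2 : B *m G *m A = A.
  have /submxP [V eV] := sub.
  by rewrite -sA eV trmx_mul sB mulmxA h3.
have : \tr A = - \tr A.
  rewrite -{1}h1 mxtrace_mulC mulmxA.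
  have -> : B *m A = - (A *m B) by apply/eqP; rewrite -addr_eq0 addrC eAB.
  by rewrite mulNmx raddfN /= -mulmxA mxtrace_mulC h2.
by move=> ?; lra.
Qed.

(** * Words and noncommutative polynomials evaluated at a pair of matrices *)

Section WordEval.
Context {R : realType} {t : nat}.
Implicit Types (A B : 'M[R]_t) (w : word).

Lemma word_eval_cat A B (v w : word) :
  word_eval A B (v ++ w) = word_eval A B v *m word_eval A B w.
Proof. by elim: v => [|l v IH] /=; rewrite ?mul1mx // IH mulmxA. Qed.

Lemma word_eval_rev A B w : A^T = A -> B^T = B ->
  word_eval A B (rev w) = (word_eval A B w)^T.
Proof.
move=> sA sB; elim: w => [|l w IH]; first by rewrite trmx1.
rewrite rev_cons -cats1 word_eval_cat IH /= trmx_mul mulmx1.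
by case: l; rewrite /= ?sA ?sB.
Qed.

Lemma word_eval0 w : w != [::] -> word_eval (0 : 'M[R]_t) 0 w = 0.
Proof. by case: w => // l w _ /=; rewrite if_same mul0mx. Qed.

(** The value at [(A, B)] of the noncommutative polynomial of degree at most 2 with coefficient
    vector [v]. *)
Definition poly_eval A B (v : 'cV[R]_7) : 'M[R]_t :=
  \sum_j v j 0 *: word_eval A B (tnth monomials j).

Lemma poly_evalD A B u v :
  poly_eval A B (u + v) = poly_eval A B u + poly_eval A B v.
Proof.
by rewrite -big_split; apply: eq_bigr => j _; rewrite mxE scalerDl.
Qed.

Lemma poly_evalN A B v : poly_eval A B (- v) = - poly_eval A B v.
Proof. by rewrite -sumrN; apply: eq_bigr => j _; rewrite mxE scaleNr. Qed.

Lemma poly_eval_delta A B j :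
  poly_eval A B (delta_mx j 0) = word_eval A B (tnth monomials j).
Proof.
rewrite /poly_eval (bigD1 j) //= mxE !eqxx scale1r big1 ?addr0 // => k /negPf nk.
by rewrite mxE nk scale0r.
Qed.

Lemma poly_eval_gram A B v : A^T = A -> B^T = B ->
  (poly_eval A B v)^T *m poly_eval A B v = \sum_i \sum_j (v i 0 * v j 0) *:
    word_eval A B (rev (tnth monomials i) ++ tnth monomials j).
Proof.
move=> sA sB; rewrite /poly_eval (raddf_sum trmx) /= mulmx_suml; apply: eq_bigr => i _.
rewrite mulmx_sumr; apply: eq_bigr => j _.
rewrite word_eval_cat word_eval_rev //.
by rewrite -scalemxAr [(_ *: _)^T]linearZ /= -scalemxAl scalerA mulrC.
Qed.

End WordEval.

(** * The moment matrix as a quadratic form on polynomials *)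

Lemma size_monomials (i : 'I_7) : (size (tnth monomials i) <= 2)%N.
Proof.
by case: i => [[|[|[|[|[|[|[|]]]]]]]].
Qed.

Lemma size_moment_word (i j : 'I_7) :
  (size (rev (tnth monomials i) ++ tnth monomials j) <= 4)%N.
Proof.
by rewrite size_cat size_rev (leq_add (size_monomials i) (size_monomials j)).
Qed.

Lemma moment_mx_sym {R : realType} (beta : word -> R) :
  is_sequence beta -> (moment_mx beta)^T = moment_mx beta.
Proof.
move=> [_ hrev]; apply/matrixP => i j; rewrite !mxE hrev ?size_moment_word //.
by rewrite rev_cat revK.
Qed.

Section Represents.
Context {R : realType} {beta : word -> R} {mu : measure R}
  (rep : represents beta mu).
Local Notation AX i := (atom_X (atom_at (m := mu) i)).
Local Notation AY i := (atom_Y (atom_at (m := mu) i)).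

(** The form is the moment functional applied to [p^* p], where [p] has coefficients [v]; each atom
    contributes the trace of a Gram matrix. *)
Lemma represents_quad (v : 'cV[R]_7) :
  (v^T *m moment_mx beta *m v) 0 0 = \sum_(k < natoms mu) density k *
    ntrace ((poly_eval (AX k) (AY k) v)^T *m poly_eval (AX k) (AY k) v).
Proof.
have [wf _ _ hb] := rep.
transitivity (\sum_i \sum_j v i 0 * v j 0 *
    beta (rev (tnth monomials i) ++ tnth monomials j)).
  rewrite mxE exchange_big; apply: eq_bigr => j _; rewrite mxE mulr_suml.
  by apply: eq_bigr => i _; rewrite !mxE; ring.
under eq_bigr => i _ do under eq_bigr => j _ do
  rewrite hb ?size_moment_word // mulr_sumr.
under eq_bigr => i _ do rewrite exchange_big.
rewrite exchange_big; apply: eq_bigr => k _ /=.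
have [_ sA sB] := wf k.
rewrite poly_eval_gram // /ntrace raddf_sum mulr_suml mulr_sumr.
apply: eq_bigr => i _; rewrite raddf_sum mulr_suml mulr_sumr.
by apply: eq_bigr => j _ /=; rewrite mxtraceZ; ring.
Qed.

Lemma ntrace_gram_ge0 t (P : 'M[R]_t) : 0 <= ntrace (P^T *m P).
Proof. by rewrite divr_ge0 ?mxtrace_gram_ge0 ?ler0n. Qed.

Lemma represents_psd : is_sequence beta -> psdmx (moment_mx beta).
Proof.
move=> hs; split=> [|v]; first exact: moment_mx_sym.
have [_ hl _ _] := rep.
rewrite represents_quad; apply: sumr_ge0 => k _.
by rewrite mulr_ge0 ?ntrace_gram_ge0 // ltW.
Qed.

(** A vanishing sum of nonnegative Gram traces with positive weights vanishes termwise. Column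
    relations thus become relations satisfied by every atom. *)
Lemma represents_kernel (v : 'cV[R]_7) k :
  moment_mx beta *m v = 0 -> poly_eval (AX k) (AY k) v = 0.
Proof.
move=> e; have [wf hl _ _] := rep.
have := represents_quad v; rewrite -mulmxA e mulmx0 mxE => /esym/eqP.
rewrite psumr_eq0 => [|i _]; last by rewrite mulr_ge0 ?ntrace_gram_ge0 // ltW.
move=> /allP /(_ k (mem_index_enum k)) /=.
have [t0 _ _] := wf k.
rewrite mulf_eq0 gt_eqF ?hl //= mulf_eq0 invr_eq0 pnatr_eq0 eqn0Ngt t0 orbF.
by move=> /eqP; apply: mxtrace_gram_eq0.
Qed.

End Represents.

(** * Moments determined by the column relations *)

Definition mon_idx (w : word) : 'I_7 := inord (index w monomials).

Lemma mon_idxK w :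
  w \in (monomials : seq word) -> tnth monomials (mon_idx w) = w.
Proof.
move=> hw; rewrite (tnth_nth [::]) inordK ?nth_index //.
by move: hw; rewrite -index_mem.
Qed.

Lemma moment_colE {R : realType} (beta : word -> R) w :
  moment_col beta w = moment_mx beta *m delta_mx (mon_idx w) 0.
Proof. exact: colE. Qed.

Lemma moment_col_entry {R : realType} (beta : word -> R) u w :
  u \in (monomials : seq word) -> w \in (monomials : seq word) ->
  moment_col beta w (mon_idx u) 0 = beta (rev u ++ w).
Proof. by move=> hu hw; rewrite !mxE !mon_idxK. Qed.

Lemma mulmx_letters {R : realType} {t} (A B : 'M[R]_t) (l m : letter) :
  word_eval A B [:: l; m] =
  (if l == lX then A else B) *m (if m == lX then A else B).
Proof. by rewrite /= mulmx1. Qed.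

(** Intended for length at most 4, where the last branch means length 4. There the two alternating
    words are the ones an odd number of letter swaps away from [XXYY], whence the sign. *)
Definition std_moment {R : realType} (a b : R) (w : word) : R :=
  if odd (count_mem lX w) || odd (count_mem lY w) then 0 else
  match size w with
  | 0%N => 1
  | 2%N => a
  | _ => if w \in [:: [:: lX; lY; lX; lY]; [:: lY; lX; lY; lX]] then - b else b
  end.

Section Moments.
Context {R : realType} {beta : word -> R} (hbeta : is_sequence beta)
  (hrel1 : moment_col beta [:: lX; lY] + moment_col beta [:: lY; lX] = 0)
  (hrel2 : moment_col beta [:: lX; lX] = moment_col beta [:: lY; lY]).

Lemma moment_anticomm u : u \in (monomials : seq word) ->
  beta (rev u ++ [:: lX; lY]) = - beta (rev u ++ [:: lY; lX]).
Proof.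
move=> hu; apply/eqP; rewrite -addr_eq0 -!moment_col_entry //.
by move/matrixP/(_ (mon_idx u) 0): hrel1; rewrite [LHS]mxE [RHS]mxE => ->.
Qed.

Lemma moment_sqr u : u \in (monomials : seq word) ->
  beta (rev u ++ [:: lX; lX]) = beta (rev u ++ [:: lY; lY]).
Proof. by move=> hu; rewrite -!moment_col_entry // hrel2. Qed.

Lemma moment_rot (v : word) : (size v <= 4)%N -> beta v = beta (rot 1 v).
Proof. by move=> hv; apply: hbeta.1 => //; exists 1%N. Qed.

(** Pairing the two relations with all seven monomials and adding the one-letter rotations gives a
    linear system for the moments. For instance [XXXY] and [XXYX] are cyclically equivalent but have
    opposite moments, so both moments vanish. *)
Lemma momentE : normalized beta -> beta [:: lX] = 0 -> beta [:: lY] = 0 ->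
  forall w, (size w <= 4)%N ->
    beta w = std_moment (beta [:: lX; lX]) (beta [:: lX; lX; lX; lX]) w.
Proof.
rewrite /normalized => b0 bX bY.
have := (moment_anticomm [::] isT, moment_anticomm [:: lX] isT,
  moment_anticomm [:: lY] isT, moment_anticomm [:: lX; lX] isT,
  moment_anticomm [:: lX; lY] isT, moment_anticomm [:: lY; lX] isT,
  moment_anticomm [:: lY; lY] isT).
have := (moment_sqr [::] isT, moment_sqr [:: lX] isT,
  moment_sqr [:: lY] isT, moment_sqr [:: lX; lX] isT,
  moment_sqr [:: lX; lY] isT, moment_sqr [:: lY; lX] isT,
  moment_sqr [:: lY; lY] isT).
have h2 l1 l2 := moment_rot [:: l1; l2] isT.
have h3 l1 l2 l3 := moment_rot [:: l1; l2; l3] isT.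
have h4 l1 l2 l3 l4 := moment_rot [:: l1; l2; l3; l4] isT.
have := h2 lX lY.
have := (h3 lX lX lY, h3 lX lY lX, h3 lX lY lY, h3 lY lX lY).
have := (h4 lX lX lX lY, h4 lX lX lY lX, h4 lX lY lX lX, h4 lY lX lX lX).
have := (h4 lY lY lY lX, h4 lY lY lX lY, h4 lY lX lY lY, h4 lX lY lY lY).
have := (h4 lX lX lY lY, h4 lX lY lY lX, h4 lY lY lX lX, h4 lX lY lX lY).
rewrite /rev /rot /= {h2 h3 h4}.
move=> [[[? ?] ?] ?] [[[? ?] ?] ?] [[[? ?] ?] ?] [[[? ?] ?] ?] ?.
move=> [[[[[[? ?] ?] ?] ?] ?] ?] [[[[[[? ?] ?] ?] ?] ?] ?].
(* Enumeration of all words of length at most 4, each settled by linear arithmetic. *)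
by case=> [|[] [|[] [|[] [|[] [|//]]]]] _; rewrite /std_moment /=; lra.
Qed.

End Moments.

(** * Consequences of rank 5 and of positivity *)

Section Rank.
Context {R : realType}.

Lemma mxrank_scaled_sqr {n} (c : R) (u : 'cV[R]_n) :
  (\rank (c *: (u *m u^T)) <= (c != 0%R))%N.
Proof.
have [->|_] := eqVneq c 0%R; first by rewrite scale0r mxrank0.
rewrite (leq_trans (mxrank_scale _ _)) // (leq_trans (mxrankM_maxl _ _)) //.
exact: rank_leq_col.
Qed.

(** Short lists are padded by zeros, the default value of [nth]. *)
Definition cvec (s : seq R) : 'cV[R]_7 := \col_i s`_i.

(** A decomposition into weighted rank-one squares; [b - a^2] comes from the Schur complement of the
    entry 1 in the block of [1, X^2, Y^2]. *)
Lemma moment_mx_std {beta : word -> R} {a b : R} :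
  (forall w, (size w <= 4)%N -> beta w = std_moment a b w) ->
  moment_mx beta = 1 *: (cvec [:: 1; 0; 0; a; 0; 0; a] *m (cvec [:: 1; 0; 0; a; 0; 0; a])^T)
    + a *: (cvec [:: 0; 1] *m (cvec [:: 0; 1])^T)
    + a *: (cvec [:: 0; 0; 1] *m (cvec [:: 0; 0; 1])^T)
    + b *: (cvec [:: 0; 0; 0; 0; 1; -1] *m (cvec [:: 0; 0; 0; 0; 1; -1])^T)
    + (b - a ^+ 2) *: (cvec [:: 0; 0; 0; 1; 0; 0; 1] *m (cvec [:: 0; 0; 0; 1; 0; 0; 1])^T).
Proof.
move=> h; apply/matrixP => i j; rewrite !mxE !big_ord1 !mxE h ?size_moment_word //.
case: i => [[|[|[|[|[|[|[|//]]]]]]] ?]; case: j => [[|[|[|[|[|[|[|//]]]]]]] ?];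
  rewrite /std_moment /=; ring.
Qed.

(** Five terms of rank at most 1 reach rank 5 only if no coefficient vanishes. *)
Lemma moment_rank_bound {beta : word -> R} {a b : R} :
  (forall w, (size w <= 4)%N -> beta w = std_moment a b w) ->
  \rank (moment_mx beta) = 5%N -> a != 0 /\ b != a ^+ 2.
Proof.
move=> h hr; have: (5 <= 1 + (a != 0%R) + (a != 0%R) + 1 + (b - a ^+ 2 != 0)%R)%N.
  rewrite -{1}hr (moment_mx_std h).
  do 4 ?[apply: (leq_trans (mxrank_add _ _)); apply: leq_add];
  by rewrite (leq_trans (mxrank_scaled_sqr _ _)) // ?leq_b1.
by rewrite subr_eq0; case: eqP; case: eqP.
Qed.

(** The form takes the values [a] and [b - a^2] at the polynomials [X] and [a - X^2]. *)
Lemma moment_psd_bound {beta : word -> R} {a b : R} :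
  (forall w, (size w <= 4)%N -> beta w = std_moment a b w) ->
  psdmx (moment_mx beta) -> 0 <= a /\ a ^+ 2 <= b.
Proof.
move=> h [_ hp].
have hM i j : moment_mx beta i j = std_moment a b (rev (tnth monomials i) ++ tnth monomials j).
  by rewrite mxE h ?size_moment_word.
split.
- have := hp (cvec [:: 0; 1]).
  rewrite !mxE !big_ord_recl big_ord0 !mxE !big_ord_recl !big_ord0 !hM !mxE /std_moment /=.
  by move=> ?; lra.
- have := hp (cvec [:: a; 0; 0; -1]).
  rewrite !mxE !big_ord_recl big_ord0 !mxE !big_ord_recl !big_ord0 !hM !mxE /std_moment /=.
  by move=> ?; lra.
Qed.

End Rank.

(** * Explicit matrices of size 2 and their normal form *)

Section Matrix2.
Context {R : realType}.

Definition mx2 (p q r s : R) : 'M[R]_2 :=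
  \matrix_(i, j) if i == 0 then if j == 0 then p else q
                 else if j == 0 then r else s.

Lemma mx2_eta (A : 'M[R]_2) : A = mx2 (A 0 0) (A 0 1) (A 1 0) (A 1 1).
Proof.
apply/matrixP => -[[|[|//]] ?] [[|[|//]] ?]; rewrite !mxE /=; congr (A _ _);
  exact: val_inj.
Qed.

Lemma mx2_mul p q r s p' q' r' s' :
  mx2 p q r s *m mx2 p' q' r' s' =
  mx2 (p * p' + q * r') (p * q' + q * s') (r * p' + s * r') (r * q' + s * s').
Proof.
apply/matrixP => -[[|[|//]] ?] [[|[|//]] ?];
  by rewrite !mxE !big_ord_recl big_ord0 !mxE /= addr0.
Qed.

Lemma mx2_tr p q r s : (mx2 p q r s)^T = mx2 p r q s.
Proof. by apply/matrixP => -[[|[|//]] ?] [[|[|//]] ?]; rewrite !mxE. Qed.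

Lemma mx2_scalar (c : R) : c%:M = mx2 c 0 0 c.
Proof. by apply/matrixP => -[[|[|//]] ?] [[|[|//]] ?]; rewrite !mxE. Qed.

Lemma mx2_ntrace p q r s : ntrace (mx2 p q r s) = (p + s) / 2%:R.
Proof. by rewrite /ntrace /mxtrace !big_ord_recl big_ord0 !mxE /= addr0. Qed.

Lemma sym_traceless_mx2 (A : 'M[R]_2) : A^T = A -> \tr A = 0 ->
  exists x y, A = mx2 x y y (- x).
Proof.
move=> sA; rewrite /mxtrace !big_ord_recl big_ord0 addr0 => tA.
exists (A 0 0), (A 0 1); rewrite {1}[A]mx2_eta -{3}sA mxE; congr mx2.
by move: tA; rewrite [lift _ _](_ : _ = 1); [move=> ?; lra | apply: val_inj].
Qed.

(** With [stdY], the real Pauli matrices scaled by [c]: they anticommute and both square to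
    [c^2 I]. *)
Definition stdX (c : R) := mx2 c 0 0 (- c).
Definition stdY (c : R) := mx2 0 c c 0.

Lemma ntrace_std_word c w : (size w <= 4)%N ->
  ntrace (word_eval (stdX c) (stdY c) w) = std_moment (c ^+ 2) (c ^+ 4) w.
Proof.
by case: w => [|[] [|[] [|[] [|[] [|//]]]]] _;
  rewrite /std_moment /= ?mulmx1 ?mx2_scalar ?mx2_mul mx2_ntrace; field.
Qed.

(** The matrix with rows [(x, y)] and [(y, -x)] has the [c]-eigenvector [(c + x, y)], of squared
    length [2c(c + x)]. If [c + x = 0], then [y = 0] and [(0, 1)] serves instead. *)
Lemma unit_eigenvector2 (x y c : R) : 0 < c -> x ^+ 2 + y ^+ 2 = c ^+ 2 ->
  exists u v,
  [/\ u ^+ 2 + v ^+ 2 = 1, x * u + y * v = c * u & y * u - x * v = c * v].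
Proof.
move=> c0 e; have [xc|xc] := eqVneq (c + x) 0%R.
  have xE : x = - c by lra.
  have /eqP : y ^+ 2 = 0 by move: e; rewrite xE => ?; nra.
  by rewrite sqrf_eq0 => /eqP ->; exists 0, 1; rewrite xE; split; ring.
have p : 0 < c + x by rewrite lt_neqAle eq_sym xc /=; nra.
have d0 : 0 < 2 * c * (c + x) by rewrite !mulr_gt0.
set n := Num.sqrt (2 * c * (c + x)).
have n0 : n != 0 by rewrite gt_eqF // sqrtr_gt0.
have n2 : n ^+ 2 = 2 * c * (c + x) by rewrite sqr_sqrtr // ltW.
exists ((c + x) / n), (y / n); split.
- have y2 : y ^+ 2 = c ^+ 2 - x ^+ 2 by lra.
  by rewrite !expr_div_n -mulrDl y2 n2; field; rewrite xc gt_eqF.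
- have y2 : y * y = c * c - x * x by lra.
  by rewrite !mulrA -mulrDl y2; congr (_ / _); ring.
- by field.
Qed.

(* For a unit vector u with A u = c u, the vector B u / c is a unit
   (-c)-eigenvector of A; the two are the columns of U. *)
Lemma anticomm_mx2_std (A B : 'M[R]_2) (c : R) : 0 < c ->
  A^T = A -> B^T = B -> \tr A = 0 -> \tr B = 0 ->
  A *m B + B *m A = 0 -> A *m A = (c ^+ 2)%:M -> B *m B = (c ^+ 2)%:M ->
  exists U : 'M[R]_2, [/\ U *m U^T = 1%:M, U^T *m U = 1%:M,
    A = U *m stdX c *m U^T & B = U *m stdY c *m U^T].
Proof.
move=> c0 sA sB tA tB.
have [x [y ->]] := sym_traceless_mx2 A sA tA.
have [z [w ->]] := sym_traceless_mx2 B sB tB.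
(* For traceless symmetric matrices of size 2 the anticommutator and the squares are scalar, so
   entry [(0, 0)] carries each whole equation. *)
rewrite !mx2_mul mx2_scalar => /matrixP /(_ 0 0); rewrite !mxE /= => eAB.
move=> /matrixP /(_ 0 0); rewrite !mxE /= => eA.
move=> /matrixP /(_ 0 0); rewrite !mxE /= => eB.
have cn0 : c != 0 by rewrite gt_eqF.
have [u [v [uv e1 e2]]] : exists u v,
  [/\ u ^+ 2 + v ^+ 2 = 1, x * u + y * v = c * u & y * u - x * v = c * v].
  by apply: unit_eigenvector2 => //; rewrite !expr2; lra.
pose p := (z * u + w * v) / c; pose q := (w * u - z * v) / c.
have pE : z * u + w * v = c * p by rewrite /p; field.
have qE : w * u - z * v = c * q by rewrite /q; field.
have h0 : x * z + y * w = 0 by lra.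
have cI r s : c * r = c * s -> r = s by apply: mulfI.
(* [f1] and [f2]: [(p, q)] is a [-c]-eigenvector of [A]. [g1] and [g2]: [B] sends it to [c (u, v)].
   [o1] and [o2]: it is a unit vector orthogonal to [(u, v)]. Equations are multiplied by [c] to
   clear the denominators of [p] and [q]. *)
have f1 : x * p + y * q = - (c * p).
  apply: cI.
  have -> : c * (x * p + y * q) = x * (c * p) + y * (c * q) by ring.
  rewrite -pE -qE.
  have -> : c * (- (z * u + w * v)) = - (z * (c * u) + w * (c * v)) by ring.
  rewrite -e1 -e2; apply/eqP; rewrite -subr_eq0; apply/eqP.
  by transitivity (2 * (x * z + y * w) * u); [ring | rewrite h0; ring].
have f2 : y * p - x * q = - (c * q).
  apply: cI.
  have -> : c * (y * p - x * q) = y * (c * p) - x * (c * q) by ring.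
  rewrite -pE -qE.
  have -> : c * (- (w * u - z * v)) = - (w * (c * u) - z * (c * v)) by ring.
  rewrite -e1 -e2; apply/eqP; rewrite -subr_eq0; apply/eqP.
  by transitivity (2 * (x * z + y * w) * v); [ring | rewrite h0; ring].
have zw : z ^+ 2 + w ^+ 2 = c ^+ 2 by rewrite -eB; ring.
have g1 : z * p + w * q = c * u.
  apply: cI.
  have -> : c * (z * p + w * q) = z * (c * p) + w * (c * q) by ring.
  rewrite -pE -qE; transitivity ((z ^+ 2 + w ^+ 2) * u); first by ring.
  by rewrite zw; ring.
have g2 : w * p - z * q = c * v.
  apply: cI.
  have -> : c * (w * p - z * q) = w * (c * p) - z * (c * q) by ring.
  rewrite -pE -qE; transitivity ((z ^+ 2 + w ^+ 2) * v); first by ring.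
  by rewrite zw; ring.
have o1 : u * p + v * q = 0.
  apply: (cI); apply: (cI).
  have -> : c * (c * (u * p + v * q)) = (c * p) * (c * u) + (c * q) * (c * v) by ring.
  rewrite -pE -qE -e1 -e2.
  by transitivity ((x * z + y * w) * (u ^+ 2 + v ^+ 2)); [ring | rewrite h0; ring].
have o2 : p * p + q * q = 1.
  apply: (cI); apply: (cI).
  have -> : c * (c * (p * p + q * q)) = (c * p) ^+ 2 + (c * q) ^+ 2 by ring.
  rewrite -pE -qE; transitivity ((z ^+ 2 + w ^+ 2) * (u ^+ 2 + v ^+ 2)); first by ring.
  by rewrite zw uv; ring.
have UU : (mx2 u p v q)^T *m mx2 u p v q = 1%:M.
  rewrite mx2_tr mx2_mul mx2_scalar; congr mx2; rewrite // -?expr2 //.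
  by rewrite mulrC (mulrC q) o1.
exists (mx2 u p v q); split=> //; first exact: mulmx1C.
- rewrite -[LHS]mulmx1 -(mulmx1C UU) mulmxA; congr (_ *m _).
  by rewrite !mx2_mul !mulr0 !add0r !addr0 !mulrN !mulNr f1 f2 e1 e2
    ![_ * c]mulrC.
- rewrite -[LHS]mulmx1 -(mulmx1C UU) mulmxA; congr (_ *m _).
  by rewrite !mx2_mul !mulr0 !add0r !addr0 !mulNr pE qE g1 g2 ![_ * c]mulrC.
Qed.

End Matrix2.

(** * Atoms of size 1 and 2 up to orthogonal equivalence *)

Lemma size1_traceless_eq0 {R : realType} {t} (A : 'M[R]_t) :
  t = 1%N -> \tr A = 0 -> A = 0.
Proof.
move=> t1; move: A; rewrite t1 => A; rewrite [A]mx11_scalar mxtrace_scalar mulr1n => ->.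
exact: raddf0.
Qed.

(** The scalar is [- det A], a sum of two squares. The size enters as an equation because that of an
    atom is a record field. *)
Lemma size2_traceless_sqr {R : realType} {t} (A : 'M[R]_t) :
  t = 2%N -> A^T = A -> \tr A = 0 -> exists c : R, 0 <= c /\ A *m A = c%:M.
Proof.
move=> t2; move: A; rewrite t2 => A sA tA.
have [x [y ->]] := sym_traceless_mx2 A sA tA.
exists (x ^+ 2 + y ^+ 2); split; first by rewrite addr_ge0 ?sqr_ge0.
by rewrite mx2_mul mx2_scalar; congr mx2; ring.
Qed.

Lemma ntrace_scalar {R : realType} {t} (c : R) : (0 < t)%N ->
  ntrace (c%:M : 'M[R]_t) = c.
Proof.
by move=> t0; rewrite /ntrace mxtrace_scalar -[c *+ t]mulr_natr mulfK // pnatr_eq0 -lt0n.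
Qed.

Section AtomEquiv.
Context {R : realType}.

Lemma atom_orth_equiv_zero1 (a : atom R) : atom_size a = 1%N ->
  atom_X a = 0 -> atom_Y a = 0 -> atom_orth_equiv (@Atom R 1 0 0) a.
Proof.
case: a => t A B /= t1; move: A B; rewrite t1 => A B -> ->.
by exists 1%:M => /=; split; rewrite ?trmx1 ?mulmx1 ?mulmx0.
Qed.

Lemma atom_orth_equiv_std (a : atom R) (c : R) : 0 < c -> atom_size a = 2%N ->
  (atom_X a)^T = atom_X a -> (atom_Y a)^T = atom_Y a ->
  \tr (atom_X a) = 0 -> \tr (atom_Y a) = 0 ->
  atom_X a *m atom_Y a + atom_Y a *m atom_X a = 0 ->
  atom_X a *m atom_X a = (c ^+ 2)%:M -> atom_Y a *m atom_Y a = (c ^+ 2)%:M ->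
  atom_orth_equiv (@Atom R 2 (stdX c) (stdY c)) a.
Proof.
case: a => t A B c0 /= t2; move: A B; rewrite t2 => A B.
exact: anticomm_mx2_std.
Qed.

End AtomEquiv.

(** * Reading off the type of a measure *)

Lemma max_size_attained {R : realType} (mu : measure R) : (0 < max_size mu)%N ->
  exists i : 'I_(natoms mu), atom_size (atom_at i) = max_size mu.
Proof.
rewrite /max_size => h.
have [|i ->] := @bigop.eq_bigmax _ (fun i : 'I_(natoms mu) => atom_size (atom_at i)).
  rewrite card_ord; case: (natoms mu) (@atom_at R mu) h => // f.
  by rewrite big_ord0.
by exists i.
Qed.

Lemma nth_mtype {R : realType} (mu : measure R) k : (k < max_size mu)%N ->
  nth 0%N (mtype mu) k = natoms_of_size mu k.+1.
Proof. exact: nth_mkseq. Qed.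

Lemma size_mtype {R : realType} (mu : measure R) : size (mtype mu) = max_size mu.
Proof. exact: size_mkseq. Qed.

Lemma natoms_of_size1P {R : realType} (mu : measure R) t :
  natoms_of_size mu t = 1%N ->
  exists i : 'I_(natoms mu), forall j, (atom_size (atom_at j) == t) = (j == i).
Proof.
move=> /eqP/cards1P [i e]; exists i => j.
by move/setP/(_ j): e; rewrite !inE.
Qed.

(** * Constraints on the atoms and the type of a representing measure *)

Section Represents.
Context {R : realType} {beta : word -> R} {mu : measure R}
  (hbeta : is_sequence beta) (hnorm : normalized beta)
  (hnc : nc_sequence beta)
  (hrel1 : moment_col beta [:: lX; lY] + moment_col beta [:: lY; lX] = 0)
  (hrel2 : moment_col beta [:: lX; lX] = moment_col beta [:: lY; lY])
  (rep : represents beta mu).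
Local Notation AX i := (atom_X (atom_at (m := mu) i)).
Local Notation AY i := (atom_Y (atom_at (m := mu) i)).

(** The column relation puts the coefficient vector of [XY + YX] in the kernel of the moment
    matrix. *)
Lemma atom_anticomm i : AX i *m AY i + AY i *m AX i = 0.
Proof.
have := represents_kernel rep
  (delta_mx (mon_idx [:: lX; lY]) 0 + delta_mx (mon_idx [:: lY; lX]) 0) i.
rewrite mulmxDr -!moment_colE hrel1 => /(_ erefl).
by rewrite poly_evalD !poly_eval_delta !mon_idxK // !mulmx_letters.
Qed.

Lemma atom_sqr i : AX i *m AX i = AY i *m AY i.
Proof.
have := represents_kernel rep
  (delta_mx (mon_idx [:: lX; lX]) 0 - delta_mx (mon_idx [:: lY; lY]) 0) i.
rewrite mulmxDr mulmxN -!moment_colE hrel2 subrr => /(_ erefl).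
rewrite poly_evalD poly_evalN !poly_eval_delta !mon_idxK // !mulmx_letters /=.
by move/eqP; rewrite subr_eq0 => /eqP.
Qed.

Lemma atom_traceless i : \tr (AX i) = 0 /\ \tr (AY i) = 0.
Proof.
have [wf _ _ _] := rep; have [_ sX sY] := wf i.
split; first exact: anticomm_mxtrace0 sX sY (atom_anticomm i) (atom_sqr i).
apply: anticomm_mxtrace0 sY sX _ (esym (atom_sqr i)).
by rewrite addrC atom_anticomm.
Qed.

Lemma moment_letter l : beta [:: l] = 0.
Proof.
have [_ _ _ ->] // := rep; apply: big1 => i _.
have [tX tY] := atom_traceless i.
by rewrite /ntrace /= mulmx1; case: l; rewrite /= ?tX ?tY mul0r mulr0.
Qed.

Lemma represents_moment w : (size w <= 4)%N ->
  beta w = std_moment (beta [:: lX; lX]) (beta [:: lX; lX; lX; lX]) w.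
Proof.
exact: momentE hbeta hrel1 hrel2 hnorm (moment_letter _) (moment_letter _) w.
Qed.

(** The moments of [XXYY] and [XYXY] are [b] and [-b], and they differ for a nc sequence. *)
Lemma moment4_neq0 : beta [:: lX; lX; lX; lX] != 0.
Proof.
apply/eqP => b0; apply: hnc.
by rewrite represents_moment // [RHS]represents_moment // /std_moment /= b0 oppr0.
Qed.

Lemma size1_atom i :
  atom_size (atom_at (m := mu) i) = 1%N -> AX i = 0 /\ AY i = 0.
Proof.
by move=> h; have [tX tY] := atom_traceless i; split; apply: size1_traceless_eq0.
Qed.

Lemma size1_moment i w : atom_size (atom_at (m := mu) i) = 1%N -> w != [::] ->
  ntrace (word_eval (AX i) (AY i) w) = 0.
Proof.
move=> h nw; have [-> ->] := size1_atom i h.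
by rewrite word_eval0 // /ntrace mxtrace0 mul0r.
Qed.

Lemma max_size_gt1 : (1 < max_size mu)%N.
Proof.
rewrite ltnNge; apply/negP => h; have [wf _ _ hb] := rep.
have := moment4_neq0; rewrite hb // big1 ?eqxx // => i _.
rewrite size1_moment ?mulr0 //; have [t0 _ _] := wf i.
by apply/eqP; rewrite eqn_leq t0 andbT (leq_trans _ h) // (bigop.leq_bigmax i).
Qed.

(** All other atoms have size 1, hence are zero, and contribute only to the empty word. Here [c] is
    the square of the scale in [stdX]. *)
Lemma single_size2_atom : max_size mu = 2%N -> natoms_of_size mu 2 = 1%N ->
  exists i : 'I_(natoms mu), exists c : R,
  [/\ forall j, atom_size (atom_at j) = if j == i then 2%N else 1%N,
      AX i *m AX i = c%:M, 0 < c,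
      beta [:: lX; lX] = density i * c &
      beta [:: lX; lX; lX; lX] = density i * c ^+ 2].
Proof.
move=> m2 /natoms_of_size1P [i hi]; have [wf hl _ hb] := rep.
have sz j : atom_size (atom_at (m := mu) j) = if j == i then 2%N else 1%N.
  rewrite -hi; case: eqP => // /eqP n2; have [t0 _ _] := wf j.
  have : (atom_size (atom_at (m := mu) j) <= 2)%N by rewrite -m2 (bigop.leq_bigmax j).
  by lia.
have si : atom_size (atom_at (m := mu) i) = 2%N by rewrite sz eqxx.
have [_ sX _] := wf i.
have [c [c0 eA]] := size2_traceless_sqr (AX i) si sX (atom_traceless i).1.
have mom w : (size w <= 4)%N -> w != [::] ->
    beta w = density i * ntrace (word_eval (AX i) (AY i) w).
  move=> sw nw; rewrite hb // (bigD1 i) //= big1 ?addr0 // => j /negPf nj.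
  by rewrite size1_moment ?mulr0 // sz nj.
have e4 : beta [:: lX; lX; lX; lX] = density i * c ^+ 2.
  rewrite mom //= mulmx1 eA !mul_mx_scalar -scalemxAr eA.
  by rewrite scale_scalar_mx ntrace_scalar ?si // expr2.
exists i, c; split=> //.
- rewrite lt_neqAle c0 andbT eq_sym; apply/eqP => cz.
  by have := moment4_neq0; rewrite e4 cz expr0n mulr0 eqxx.
- by rewrite mom //= mulmx1 eA ntrace_scalar ?si.
Qed.

Lemma natoms_of_size2_gt0 : max_size mu = 2%N -> (0 < natoms_of_size mu 2)%N.
Proof.
move=> m2; have [|i hi] := max_size_attained mu; first by rewrite m2.
by apply/card_gt0P; exists i; rewrite inE hi m2.
Qed.

Context (hrank : \rank (moment_mx beta) = 5%N).

(** Otherwise the only atom has density 1, so [b = a^2], against rank 5. *)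
Lemma natoms_of_size1_gt0 : max_size mu = 2%N -> natoms_of_size mu 2 = 1%N ->
  (0 < natoms_of_size mu 1)%N.
Proof.
move=> m2 n2; have [i [c [sz _ _ ea eb]]] := single_size2_atom m2 n2.
rewrite lt0n; apply/eqP => /cards0_eq /setP n1.
have all_i j : j = i.
  by have := n1 j; rewrite !inE sz; case: (eqVneq j i).
have [_ _ h1 _] := rep.
have l1 : density i = 1.
  rewrite -h1 (bigD1 i) //= big1 ?addr0 // => j; by rewrite (all_i j) eqxx.
have [_ /eqP] := moment_rank_bound represents_moment hrank.
by apply; rewrite ea eb l1 !mul1r.
Qed.

(** A smaller type would have maximal size at most 1, or maximal size 2 with no atom of size 2, or a
    single atom of size 2 and none of size 1. *)
Lemma not_type_lt_11 : ~ type_lt (mtype mu) [:: 1%N; 1%N].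
Proof.
move: max_size_gt1 natoms_of_size2_gt0 natoms_of_size1_gt0 => m1 n2 n1.
case; rewrite size_mtype /=; first by lia.
move=> [m2 [k [hk]]]; rewrite nth_mtype //.
case: k hk => [|[|k]] //=; last 2 first.
- by move=> _ h; have := n2 m2; lia.
- by rewrite m2.
move=> _ h h1; have := n1 m2; have := h1 1%N; rewrite m2 /= nth_mtype ?m2 //= => e.
by move/(_ (e isT)); lia.
Qed.

End Represents.

(** * The representing measure of type [(1, 1)] *)

Definition std_measure {R : realType} (l c : R) : measure R :=
  @Measure R 2 (fun i => if i == 0 then 1 - l else l)
    (fun i => if i == 0 then @Atom R 1 0 0 else @Atom R 2 (stdX c) (stdY c)).

Section StdMeasure.
Context {R : realType}.

Lemma mtype_std_measure (l c : R) : mtype (std_measure l c) = [:: 1%N; 1%N].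
Proof.
rewrite /mtype; have -> : max_size (std_measure l c) = 2%N.
  by rewrite /max_size !big_ord_recl big_ord0.
have card_sz t : natoms_of_size (std_measure l c) t = ((1 == t) + (2 == t))%N.
  rewrite /natoms_of_size -sum1_card big_mkcond !big_ord_recl big_ord0 !inE /=.
  by case: eqP; case: eqP.
by rewrite /mkseq /= !card_sz.
Qed.

(** The density and the scale solve [l c^2 = a] and [l c^4 = b]; [a^2 < b] leaves the zero atom a
    positive density [1 - l]. *)
Lemma std_measure_represents (beta : word -> R) (a b : R) :
  (forall w, (size w <= 4)%N -> beta w = std_moment a b w) ->
  0 < a -> a ^+ 2 < b ->
  represents beta (std_measure (a ^+ 2 / b) (Num.sqrt (b / a))).
Proof.
move=> h a0 ab; have b0 : 0 < b by rewrite (le_lt_trans _ ab) ?sqr_ge0.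
have an : a != 0 by rewrite gt_eqF.
have bn : b != 0 by rewrite gt_eqF.
set l := a ^+ 2 / b; set c := Num.sqrt _.
have c2 : c ^+ 2 = b / a by rewrite sqr_sqrtr // divr_ge0 // ltW.
have l0 : 0 < l by rewrite divr_gt0 // exprn_gt0.
have l1 : l < 1 by rewrite ltr_pdivrMr ?mul1r.
have la : l * c ^+ 2 = a by rewrite c2 /l; field; rewrite an bn.
have lb : l * c ^+ 4 = b by rewrite -[4%N]/(2 * 2)%N exprM c2 /l; field; rewrite an bn.
split => /=.
- case=> [[|[|//]] ?] /=; split; rewrite //= ?trmx0 //; first [exact: mx2_tr].
- by case=> [[|[|//]] ?] /=; rewrite ?subr_gt0.
- by rewrite !big_ord_recl big_ord0 /= addr0 subrK.
- move=> w sw; rewrite !big_ord_recl big_ord0 /= addr0 h // ntrace_std_word //.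
  (* The zero atom contributes to the empty word alone, where the densities add up to 1. *)
  have [->|nw] := eqVneq w [::].
    by rewrite /std_moment /= ntrace_scalar // !mulr1 subrK.
  rewrite word_eval0 // /ntrace mxtrace0 mul0r mulr0 add0r.
  rewrite /std_moment; case: ifP => _; first by rewrite mulr0.
  case: w sw nw => [|? [|? [|? [|? [|//]]]]] //= _ _;
    by [rewrite la | case: ifP => _; rewrite -?la -?lb; ring].
Qed.

End StdMeasure.

(** * Uniqueness of the minimal measure *)

Section Uniqueness.
Context {R : realType} {beta : word -> R}
  (hbeta : is_sequence beta) (hnorm : normalized beta)
  (hnc : nc_sequence beta)
  (hrank : \rank (moment_mx beta) = 5%N)
  (hrel1 : moment_col beta [:: lX; lY] + moment_col beta [:: lY; lX] = 0)
  (hrel2 : moment_col beta [:: lX; lX] = moment_col beta [:: lY; lY]).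
Local Notation a := (beta [:: lX; lX]).
Local Notation b := (beta [:: lX; lX; lX; lX]).

(** The premise bounds the maximal size and then both counts from above; with the lower bounds
    already known, [nu] has type [(1, 1)]. The moments [a] and [b] then recover the densities and
    the scale. *)
Lemma std_measure_unique (nu : measure R) :
  represents beta nu -> ~ type_lt [:: 1%N; 1%N] (mtype nu) ->
  orth_equiv (std_measure (a ^+ 2 / b) (Num.sqrt (b / a))) nu.
Proof.
move=> rep nlt.
have m2 : max_size nu = 2%N.
  have h := max_size_gt1 hbeta hnorm hnc hrel1 hrel2 rep.
  apply/eqP; rewrite eqn_leq h andbT leqNgt; apply/negP => h2.
  by case: nlt; left; rewrite size_mtype.
have n2 : natoms_of_size nu 2 = 1%N.
  have h := natoms_of_size2_gt0 m2.
  apply/eqP; rewrite eqn_leq h andbT leqNgt; apply/negP => h2.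
  case: nlt; right; rewrite size_mtype m2; split=> //.
  (* Index 1 counts the atoms of size 2 and is the top entry, so no later entry has to agree. *)
  by exists 1%N; rewrite nth_mtype ?m2; split=> // j /=; lia.
have n1 : natoms_of_size nu 1 = 1%N.
  have h := natoms_of_size1_gt0 hbeta hnorm hnc hrel1 hrel2 rep hrank m2 n2.
  apply/eqP; rewrite eqn_leq h andbT leqNgt; apply/negP => h2.
  case: nlt; right; rewrite size_mtype m2; split=> //.
  exists 0%N; rewrite nth_mtype ?m2; split=> // -[|[|j]] //= _.
  by rewrite nth_mtype ?m2 ?n2.
have [i2 [d [sz eA d0 ea eb]]] :=
  single_size2_atom hbeta hnorm hnc hrel1 hrel2 rep m2 n2.
have [i1 hi1] := natoms_of_size1P nu 1 n1.
have i12 j : (j == i1) = (j != i2) by rewrite -hi1 sz; case: (eqVneq j i2).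
have [wf hl h1 _] := rep.
have l0 := hl i2.
(* Inverts [a = l d] and [b = l d^2], with [l] the density of [i2] and [d] its squared scale. *)
have le : a ^+ 2 / b = density i2.
  by rewrite ea eb; field; rewrite !gt_eqF.
have ce : b / a = d by rewrite ea eb; field; rewrite !gt_eqF.
exists (fun i => if i == 0 then i1 else i2); split.
  exists (fun j => if j == i2 then 1 else 0).
    move=> i; case: (eqVneq i 0) => [->|ni].
      by have := i12 i1; rewrite eqxx => /esym/negPf ->.
    by rewrite eqxx; apply: val_inj; case: i ni => [[|[|//]] ?].
  by move=> j; case: (eqVneq j i2) => [->//|]; rewrite -i12 => /eqP ->.
case=> [[|[|//]] ?] /=; rewrite ?le ?ce.
  split.
    (* The densities sum to 1 over the two atoms [i1] and [i2]. *)
    rewrite -h1 (bigD1 i2) //= (bigD1 i1) /= -?i12 //.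
    rewrite [X in _ + (_ + X)]big1 => [|j]; first by ring.
    by rewrite -i12 => /andP [->].
  have s1 : atom_size (atom_at i1) = 1%N by apply/eqP; rewrite hi1.
  have [z1 z2] := size1_atom hrel1 hrel2 rep i1 s1.
  exact: atom_orth_equiv_zero1.
split=> //; have [_ sX sY] := wf i2.
have [tX tY] := atom_traceless hrel1 hrel2 rep i2.
have d2 : (Num.sqrt d) ^+ 2 = d by rewrite sqr_sqrtr // ltW.
apply: atom_orth_equiv_std => //; rewrite ?d2 ?sqrtr_gt0 -?(atom_sqr hrel2 rep) //.
- by rewrite sz eqxx.
- exact: atom_anticomm hrel1 rep i2.
Qed.

End Uniqueness.

Theorem theorem6p14 (R : realType) (beta : word -> R)
  (hbeta : is_sequence beta) (hnorm : normalized beta)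
  (hnc : nc_sequence beta)
  (hrank : \rank (moment_mx beta) = 5%N)
  (hrel1 : moment_col beta [:: lX; lY] + moment_col beta [:: lY; lX] = 0)
  (hrel2 : moment_col beta [:: lX; lX] = moment_col beta [:: lY; lY]) :
  (admits_nc_measure beta <->
     [/\ psdmx (moment_mx beta), beta [:: lX] = 0 & beta [:: lY] = 0]) /\
  (admits_nc_measure beta ->
     exists mu : measure R,
       [/\ is_minimal beta mu,
           mtype mu = [:: 1%N; 1%N]
         & forall nu : measure R, is_minimal beta nu -> orth_equiv mu nu]).
Proof.
have necessary : admits_nc_measure beta ->
    [/\ psdmx (moment_mx beta), beta [:: lX] = 0 & beta [:: lY] = 0].
  move=> [mu [[rep _] _]]; split; first exact: represents_psd rep hbeta.
    exact: moment_letter hrel1 hrel2 rep _.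
  exact: moment_letter hrel1 hrel2 rep _.
(* Stated with uniqueness and type, so that it yields both the converse implication and the final
   claim. *)
have sufficient : [/\ psdmx (moment_mx beta), beta [:: lX] = 0 & beta [:: lY] = 0] ->
    exists mu : measure R,
       [/\ is_minimal beta mu,
           mtype mu = [:: 1%N; 1%N]
         & forall nu : measure R, is_minimal beta nu -> orth_equiv mu nu].
  move=> [hpsd bX bY].
  have mom := momentE hbeta hrel1 hrel2 hnorm bX bY.
  (* Rank 5 makes the weak inequalities from positivity strict. *)
  have [an ab] := moment_rank_bound mom hrank.
  have [a0 b0] := moment_psd_bound mom hpsd.
  have {an}a_gt0 : 0 < beta [:: lX; lX] by rewrite lt_neqAle eq_sym an a0.
  have {ab}b_gt : beta [:: lX; lX] ^+ 2 < beta [:: lX; lX; lX; lX].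
    by rewrite lt_neqAle eq_sym ab b0.
  have rep := std_measure_represents beta _ _ mom a_gt0 b_gt.
  exists (std_measure (beta [:: lX; lX] ^+ 2 / beta [:: lX; lX; lX; lX])
            (Num.sqrt (beta [:: lX; lX; lX; lX] / beta [:: lX; lX]))).
  split; last first.
  - move=> nu [repnu minnu]; apply: (std_measure_unique hbeta hnorm hnc) => //.
    by have := minnu _ rep; rewrite mtype_std_measure.
  - exact: mtype_std_measure.
  - split=> // nu repnu; rewrite mtype_std_measure.
    exact: (not_type_lt_11 hbeta hnorm hnc hrel1 hrel2 repnu hrank).
split; last by move/necessary/sufficient.
split=> // /sufficient [mu [minmu tmu _]].
by exists mu; rewrite tmu.
Qed.
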